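(* Let $K$ be a commutative integral domain with identity of characteristic $0$, $n\ge1$, and let $\mathcal F=\sum_{|\alpha|=0}^{\infty}a_\alpha D^\alpha$ ($a_\alpha\in K$) be a linear differential operator of infinite order on $K[x_1,\dots,x_n]'$ with $a_0=0$ (where $a_0$ is the coefficient with $\alpha=(0,\dots,0)$). Then for any copolynomial $Q\in K[x_1,\dots,x_n]'$ the formal power series $$u(t,x)=\sum_{k=0}^{\infty}\frac{(\mathcal F^kQ)(x)}{k!}t^k\in K[x_1,\dots,x_n]'[[t]]$$ is well defined and is the unique solution in $K[x_1,\dots,x_n]'[[t]]$ of the Cauchy problem $$\frac{\partial u(t,x)}{\partial t}=(\mathcal F u)(t,x),\qquad u(0,x)=Q(x).$$ Furthermore, for every $t\in K$ the series $\sum_{k=0}^{\infty}\frac{(\mathcal F^kQ)(x)}{k!}t^k$ converges in the topology of the module $K[x_1,\dots,x_n]'$.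
   Context: A copolynomial over $K$ is a $K$-linear map $T:K[x_1,\dots,x_n]\to K$; $K[x_1,\dots,x_n]'$ is the $K$-module of copolynomials, and $(T,p)$ denotes the value of $T$ at $p$. Topology: $K$ is discrete and $K[x_1,\dots,x_n]'$ carries the topology of pointwise convergence; so $T_k\to T$ iff for every polynomial $p$ there is $k_0$ with $(T_k,p)=(T,p)$ for all $k\ge k_0$. A series converges if its partial sums converge. For $\alpha\in\mathbb N_0^n$, $|\alpha|=\sum_j\alpha_j$, $D^\alpha=\frac{\partial^{|\alpha|}}{\partial x_1^{\alpha_1}\cdots\partial x_n^{\alpha_n}}$, and $(D^\alpha T,p)=(-1)^{|\alpha|}(T,D^\alpha p)$. The operator $\mathcal F=\sum_{|\alpha|=0}^\infty a_\alpha D^\alpha$ acts by $(\mathcal F T,p)=\sum_{|\alpha|\le m}a_\alpha (D^\alpha T,p)$ where $m=\deg p$. $K[x_1,\dots,x_n]'[[t]]$ is the module of formal power series $u(t,x)=\sum_{k\ge0}u_k(x)t^k$ with $u_k\in K[x_1,\dots,x_n]'$; $\frac{\partial u}{\partial t}=\sum_{k\ge1}k u_k t^{k-1}$, $\mathcal F u=\sum_{k\ge0}(\mathcal F u_k)t^k$, $u(0,x)=u_0(x)$. The expression $\frac{\mathcal F^kQ}{k!}$ denotes the copolynomial $S$ with $k!\,S=\mathcal F^kQ$; ''well defined'' means that for every $k$ such an $S$ exists in $K[x_1,\dots,x_n]'$ and is unique. *)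

(* Defs.v *)
From HB Require Import structures.
From mathcomp Require Import all_boot all_order all_algebra.
From mathcomp Require Import boolp classical_sets functions filter.
From mathcomp Require Import topology function_spaces.
From mathcomp Require Import ssrcomplements.
From mathcomp Require Export mpoly.

Set Implicit Arguments.
Unset Strict Implicit.
Unset Printing Implicit Defensive.

Import GRing.Theory.
Local Open Scope classical_set_scope.
Local Open Scope ring_scope.

Definition copoly (n : nat) (K : comNzRingType) : Type :=
  {linear {mpoly K[n]} -> K^o}.

Section Copoly.
Variables (n : nat) (K : comNzRingType).
Local Notation poly := {mpoly K[n]}.
Local Notation copoly := (copoly n K).
Implicit Types (T S : copoly) (p : poly) (c : K).

Definition copoly_val T : poly -> K := (T : {linear poly -> K^o}).
Coercion copoly_val : copoly >-> Funclass.

Lemma copolyP T S : (forall p, T p = S p) -> T = S.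
Proof.
case: T => T [[T1] [T2]]; case: S => S [[S1] [S2]].
rewrite /copoly_val /= => TS; have {}TS : T = S by apply/funext.
by case: S / TS in S1 S2 *; rewrite (Prop_irrelevance T1 S1)
  (Prop_irrelevance T2 S2).
Qed.

Lemma copoly_linear T c p q : T (c *: p + q) = c * T p + T q.
Proof. exact: (linearP (T : {linear poly -> K^o})). Qed.

HB.instance Definition _ := gen_eqMixin copoly.
HB.instance Definition _ := gen_choiceMixin copoly.

Definition copoly0 : copoly := (\0 : {linear poly -> K^o}).
Definition copolyN T : copoly :=
  (\- (T : {linear poly -> K^o}) : {linear poly -> K^o}).
Definition copolyA T S : copoly :=
  ((T : {linear poly -> K^o}) \+ (S : {linear poly -> K^o})
    : {linear poly -> K^o}).
Definition copolyZ c T : copoly :=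
  (c \*: (T : {linear poly -> K^o}) : {linear poly -> K^o}).

Fact copolyAA : associative copolyA.
Proof. by move=> T S U; apply: copolyP => p; apply: addrA. Qed.
Fact copolyAC : commutative copolyA.
Proof. by move=> T S; apply: copolyP => p; apply: addrC. Qed.
Fact copoly0A : left_id copoly0 copolyA.
Proof. by move=> T; apply: copolyP => p; apply: add0r. Qed.
Fact copolyNA : left_inverse copoly0 copolyN copolyA.
Proof. by move=> T; apply: copolyP => p; apply: addNr. Qed.

HB.instance Definition _ :=
  GRing.isZmodule.Build copoly copolyAA copolyAC copoly0A copolyNA.

Fact copolyZA c d T : copolyZ c (copolyZ d T) = copolyZ (c * d) T.
Proof. by apply: copolyP => p; apply: mulrA. Qed.
Fact copoly1Z : left_id 1 copolyZ.
Proof. by move=> T; apply: copolyP => p; apply: mul1r. Qed.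
Fact copolyZDr : right_distributive copolyZ +%R.
Proof. by move=> c T S; apply: copolyP => p; apply: mulrDr. Qed.
Fact copolyZDl T : {morph copolyZ^~ T : c d / c + d}.
Proof. by move=> c d; apply: copolyP => p; apply: mulrDl. Qed.

HB.instance Definition _ :=
  GRing.Zmodule_isLmodule.Build K copoly copolyZA copoly1Z copolyZDr copolyZDl.

(* Pointwise convergence, the ring of scalars being discrete. *)
HB.instance Definition _ := Topological.copy copoly
  (initial_topology (copoly_val : copoly -> {ptws poly -> discrete_topology K})).

Lemma copoly_cvgP (T_ : nat -> copoly) T :
  T_ @ \oo --> T <->
  forall p, exists k0, forall k, (k0 <= k)%N -> T_ k p = T p.
Proof.
split=> [cvT p|cvT].
  have /(_ [set T p]) : (fun k => T_ k p : discrete_topology K) @ \oo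
      --> (T p : discrete_topology K).
    apply: (@cvg_comp _ _ _ (copoly_val \o T_) (fun f => f p) _ _ _ _
      (@proj_continuous _ (fun=> discrete_topology K) p (copoly_val T))).
    exact: (cvg_comp _ _ cvT (@initial_continuous _
      {ptws poly -> discrete_topology K} copoly_val T)).
  by case=> [|k0 _ k0P]; [exact: discrete_set1 | exists k0 => k /k0P].
have {}cvT : (fun k => copoly_val (T_ k)) @ \oo
    --> (copoly_val T : {ptws poly -> discrete_topology K}).
  apply/cvg_sup => p; apply/cvg_image.
    by rewrite eqEsubset; split=> // c _; exists (fun=> c).
  have [k0 k0P] := cvT p.
  move=> A /principal_filterP Ap; exists [set f | A (f p)].
    by exists k0 => // k /k0P /= ->.
  by rewrite eqEsubset; split=> [_ [f Af <-] //|c Ac]; exists (fun=> c).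
move=> A /= [_ [[B oB <-] BT BA]].
have /cvT : nbhs (copoly_val T : {ptws poly -> discrete_topology K}) B.
  by apply: open_nbhs_nbhs.
by case=> k0 _ k0B; exists k0 => // k /k0B Bk; apply: BA.
Qed.

Definition copolyD (m : 'X_{1..n}) T : copoly :=
  ((-1) ^+ mdeg m \*: ((T : {linear poly -> K^o}) \o mderivm m)
    : {linear poly -> K^o}).

Lemma copolyDE m T p : copolyD m T p = (-1) ^+ mdeg m * T (mderivm m p).
Proof. by []. Qed.

Lemma mderivm_eq0 (m : 'X_{1..n}) p : (msize p <= mdeg m)%N -> mderivm m p = 0.
Proof.
move=> le_pm; rewrite mderivmE big1_seq // => m' /andP[_ /msize_mdeg_lt lt_m'p].
suff [i lt_i] : exists i, (m' i < m i)%N.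
  by rewrite (bigD1 i) //= ffact_small // mul0n mulr0 scale0r.
apply/existsP; apply: contraLR (leq_trans lt_m'p le_pm) => /existsPn le_mm'.
by rewrite -leqNgt !mdegE leq_sum // => i _; rewrite leqNgt.
Qed.

(* [mdeg m < msize p] amounts to |m| <= deg p when p != 0. *)
Definition diffop_fun (a : 'X_{1..n} -> K) T p : K^o :=
  \sum_(m : 'X_{1..n < msize p}) a m * copolyD m T p.

Lemma diffop_funwE a T p k : (msize p <= k)%N ->
  diffop_fun a T p = \sum_(m : 'X_{1..n < k}) a m * copolyD m T p.
Proof.
move=> le_pk; pose F (m : 'X_{1..n}) := a m * copolyD m T p.
rewrite /diffop_fun (big_sub_widen 'X_{1..n < msize p} 'X_{1..n < k} xpredT F).
  rewrite big_rmcond //= => m; rewrite -leqNgt /F => /mderivm_eq0 pm0.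
  by rewrite copolyDE pm0 [T 0](linear0 T) !mulr0.
by move=> m /leq_trans; apply.
Qed.

Fact diffop_fun_is_linear a T : linear (diffop_fun a T).
Proof.
move=> c p q; set k := maxn (msize (c *: p + q)) (maxn (msize p) (msize q)).
rewrite !(@diffop_funwE a T _ k) ?leq_max ?leqnn ?orbT //.
rewrite scaler_sumr -big_split; apply: eq_bigr => m _.
by rewrite copoly_linear mulrDr mulrCA.
Qed.

HB.instance Definition _ a T :=
  GRing.isLinear.Build K poly K^o *:%R (diffop_fun a T)
    (diffop_fun_is_linear a T).

Definition diffop a T : copoly := (diffop_fun a T : {linear poly -> K^o}).

(* Formal power series in t: [u k] is the coefficient of t^k. *)
Definition copoly_series := nat -> copoly.

Definition dt (u : copoly_series) : copoly_series := fun k => u k.+1 *+ k.+1.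

Definition diffop_series a (u : copoly_series) : copoly_series :=
  fun k => diffop a (u k).

Definition cauchy_solution a Q (u : copoly_series) : Prop :=
  dt u = diffop_series a u /\ u 0%N = Q.

End Copoly.

(* Main.v *)
From HB Require Import structures.
Require Import Defs.
From mathcomp Require Import all_boot all_order all_algebra.
From mathcomp Require Import boolp classical_sets functions filter.
From mathcomp Require Import topology function_spaces mpoly.

Set Implicit Arguments.
Unset Strict Implicit.
Unset Printing Implicit Defensive.

Import GRing.Theory.
Local Open Scope classical_set_scope.
Local Open Scope ring_scope.

(** Division by [k!] need not be possible in [K]; the point is that it divides
  every value of [F^k Q].  Transposing, the value of [F^k Q] at [p] is the value of
  [Q] at [G^k p], where [G = \sum_m (-1)^|m| a_m D^m]; for polynomials of a
  bounded degree, [G] is a finite sum.  It is therefore enough that [k!] divides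
  the polynomial [G^k p].

  Call [G] an operator with divided powers when [k!] divides all values of [G^k]
  for all [k].  If two commuting operators have divided powers, so has their
  sum, for in the binomial formula
  [(G + H)^k = \sum_i C(k, i) G^i H^(k - i)] the factor [i! (k - i)!] provided
  by [G^i] and [H^(k - i)] turns [C(k, i)] into [k!]
  ([has_divided_powersD]).  A single term [c D^m] with [m <> 0] has divided
  powers: its [k]-th power differentiates at least [k] times in one of the
  variables, and a product of [k] or more consecutive integers is a multiple of
  [k!] ([has_divided_powers_mderivm]).  This fails for [m = 0], as all powers
  of the identity are equal; hence the assumption on [a_0].

  In characteristic [0] the quotients by [k!] are unique, hence linear in [p],
  and they form copolynomials [u_k] ([copoly_fact_div]).  The equation
  [(k + 1) u_(k + 1) = F u_k], multiplied by [k!], says by induction that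
  [k! u_k = F^k Q]; so the series is the only solution.

  Finally each [D^m] with [m <> 0] lowers the degree, so [F^k Q], and with it
  [u_k], vanishes on the polynomials of degree less than [k]
  ([iter_diffop_vanish]).  The partial sums of the series at a given polynomial
  are then eventually constant, and such pointwise limits of copolynomials are
  copolynomials ([copoly_stationary_cvg]). *)

(** * Operators whose k-th power is divisible by k! *)

Section DividedPowers.
Variable V : zmodType.

(** Only the divisibility of each value is asked, not an operator [E_k] with
  [G^k = k! E_k]: where multiplication by [k!] is injective the quotients form
  such an operator on their own. *)
Definition has_divided_powers (G : V -> V) : Prop :=
  forall k x, exists y, iter k G x = y *+ k`!.

Lemma iter_mulrn (G : {additive V -> V}) k m x :
  iter k G (x *+ m) = iter k G x *+ m.
Proof. by elim: k => [|k IHk] //=; rewrite IHk raddfMn. Qed.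

Lemma iter_comm (G H : V -> V) k :
  (forall x, G (H x) = H (G x)) -> forall x, G (iter k H x) = iter k H (G x).
Proof. by move=> GH; elim: k => [|k IHk] x //=; rewrite GH IHk. Qed.

Lemma iter_add_binomial (G H : {additive V -> V}) k x :
    (forall y, G (H y) = H (G y)) ->
  iter k (G \+ H) x =
    \sum_(i < k.+1) iter i G (iter (k - i) H x) *+ 'C(k, i).
Proof.
move=> GH; elim: k => [|k IHk]; first by rewrite big_ord1.
rewrite iterS IHk [in RHS]big_ord_recl bin0 subn0 /= !raddf_sum.
have -> : \sum_(i < k.+1) iter (bump 0 i) G (iter (k.+1 - bump 0 i) H x)
            *+ 'C(k.+1, bump 0 i) =
    \sum_(i < k.+1) iter i.+1 G (iter (k - i) H x) *+ 'C(k, i.+1) +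
    \sum_(i < k.+1) iter i.+1 G (iter (k - i) H x) *+ 'C(k, i).
  by rewrite -big_split; apply: eq_bigr => i _; rewrite binS mulrnDr.
rewrite addrA [LHS]addrC; congr (_ + _).
  rewrite [in RHS]big_ord_recr /= bin_small // mulr0n addr0.
  rewrite big_ord_recl /= bin0 subn0 raddfMn; congr (_ + _).
  apply: eq_bigr => i _; rewrite raddfMn [bump 0 i]add1n.
  by rewrite add0n -iterS (@iter_comm H G) // -[H _]iterS subnSK.
by apply: eq_bigr => i _; rewrite raddfMn.
Qed.

(** The divided powers of a sum are the convolution of those of its terms, as
  for [exp (G + H) = exp G exp H]. *)
Lemma has_divided_powersD (G H : {additive V -> V}) :
    (forall x, G (H x) = H (G x)) ->
  has_divided_powers G -> has_divided_powers H -> has_divided_powers (G \+ H).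
Proof.
move=> GH divG divH k x; rewrite iter_add_binomial //.
have /boolp.choice[y yP] (i : 'I_k.+1) :
    exists y, iter i G (iter (k - i) H x) *+ 'C(k, i) = y *+ k`!.
  have [y ->] := divH (k - i)%N x; have [z zP] := divG i y; exists z.
  by rewrite iter_mulrn zP -!mulrnA mulnA mulnC bin_fact // -ltnS.
by exists (\sum_i y i); rewrite -sumrMnl; apply: eq_bigr => i _.
Qed.

Lemma has_divided_powers0 : has_divided_powers (fun _ : V => 0).
Proof. by case=> [|k] x; [exists x | exists 0; rewrite mul0rn]. Qed.

Lemma has_divided_powers_ext (G H : V -> V) :
  G =1 H -> has_divided_powers G -> has_divided_powers H.
Proof.
by move=> GH divG k x; have [y Gy] := divG k x; exists y; rewrite -(eq_iter GH).
Qed.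

End DividedPowers.

(** * Divisibility and degrees of derivatives *)

Section Derivatives.
Variables (n : nat) (R : comNzRingType).
Implicit Types (p : {mpoly R[n]}) (m : 'X_{1..n}).

(** The [i]-th factor [m'_i (m'_i - 1) ... (m'_i - m_i + 1)] of the coefficients
  of [D^m] is [m_i!] times a binomial coefficient. *)
Lemma mderivm_fact_dvd m p (i : 'I_n) k :
  (k <= m i)%N -> exists q, mderivm m p = q *+ k`!.
Proof.
move=> le_km; have kdvd m' : (k`! %| \prod_(j < n) m' j ^_ m j)%N.
  rewrite (bigD1 i) //= -bin_ffact; apply/dvdn_mulr/dvdn_mull.
  by rewrite -(bin_fact le_km) dvdn_mull // dvdn_mulr.
pose c m' := ((\prod_(j < n) m' j ^_ m j) %/ k`!)%N.
exists (\sum_(m' <- msupp p) (p@_m' * (c m')%:R) *: 'X_[m' - m]).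
rewrite mderivmE -sumrMnl; apply: eq_bigr => m' _.
by rewrite scalerMnl -mulrnAr -mulrnA divnK.
Qed.

Lemma has_divided_powers_mderivm c m : m != 0%MM ->
  has_divided_powers (fun p : {mpoly R[n]} => c *: mderivm m p).
Proof.
move=> m_neq0 k p.
have -> : iter k (fun p => c *: mderivm m p) p = c ^+ k *: mderivm (m *+ k) p.
  elim: k => [|k IHk] /=; first by rewrite mulm0n mderivm0m scale1r.
  by rewrite IHk mderivmZ scalerA -exprS -mderivmDm addmC -mulmS.
have [i mi_gt0] : exists i, m i != 0%N.
  apply/existsP; apply: contraNT m_neq0 => /existsPn m0.
  by apply/eqP/mnmP => i; rewrite mnm0E; apply/eqP; move: (m0 i); rewrite negbK.
have [|q ->] := @mderivm_fact_dvd (m *+ k) p i k.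
  by rewrite mulmnE leq_pmull // lt0n.
by exists (c ^+ k *: q); rewrite scalerMnr.
Qed.

Lemma msize_mderivm m p : (msize (mderivm m p) <= msize p - mdeg m)%N.
Proof.
rewrite mderivmE; apply: leq_trans (msize_sum _ _ _) _.
apply/bigmax_leqP_seq => m' m'p _.
have [le_mm'|] := boolP (m <= m')%MM; last first.
  (* The truncated difference [m' - m] is meaningless here, but its monomial
     has a coefficient 0. *)
  move=> /forallPn [i]; rewrite -ltnNge => lt_i.
  by rewrite (bigD1 i) //= ffact_small // mul0n mulr0 scale0r msize0.
apply: leq_trans (msizeZ_le _ _) _; rewrite msizeX.
have := msize_mdeg_lt m'p.
by rewrite -{1}(submK le_mm') mdegD addnC -ltn_subRL.
Qed.

End Derivatives.

(** * Finite operators with constant coefficients *)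

Section ConstantCoefficients.
Variables (n : nat) (R : comNzRingType).
Variables (c : 'X_{1..n} -> R) (s : seq 'X_{1..n}).
Implicit Types (p : {mpoly R[n]}).

Definition const_diffop p := \sum_(m <- s) c m *: mderivm m p.

Fact const_diffop_is_linear : linear const_diffop.
Proof.
move=> b p q; rewrite /const_diffop scaler_sumr -big_split /=.
apply: eq_bigr => m _.
by rewrite linearP scalerDr !scalerA mulrC.
Qed.

HB.instance Definition _ :=
  GRing.isLinear.Build R {mpoly R[n]} {mpoly R[n]} _ const_diffop
    const_diffop_is_linear.

Lemma const_diffop_mderivm m p :
  const_diffop (mderivm m p) = mderivm m (const_diffop p).
Proof.
rewrite /const_diffop raddf_sum; apply: eq_bigr => m' _ /=.
by rewrite mderivmZ -!mderivmDm addmC.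
Qed.

Lemma msize_const_diffop p : (msize (const_diffop p) <= msize p)%N.
Proof.
apply: leq_trans (msize_sum _ _ _) _; apply/bigmax_leqP_seq => m _ _.
apply: leq_trans (msizeZ_le _ _) _.
by apply: leq_trans (msize_mderivm _ _) _; apply: leq_subr.
Qed.

End ConstantCoefficients.

Lemma has_divided_powers_const_diffop (n : nat) (R : comNzRingType)
    (c : 'X_{1..n} -> R) (s : seq 'X_{1..n}) :
  c 0%MM = 0 -> has_divided_powers (const_diffop c s).
Proof.
move=> c0; elim: s => [|m s IHs].
  apply: has_divided_powers_ext (@has_divided_powers0 _) => p.
  by rewrite /const_diffop big_nil.
have GD : (c m \*: mderivm m) \+ const_diffop c s =1 const_diffop c (m :: s).
  by move=> p; rewrite /const_diffop big_cons.
apply: (has_divided_powers_ext GD); apply: has_divided_powersD => [p||//].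
  by rewrite [RHS]linearZ /= const_diffop_mderivm.
have [->|m_neq0] := eqVneq m 0%MM; last exact: has_divided_powers_mderivm.
apply: has_divided_powers_ext (@has_divided_powers0 _) => p.
by rewrite /= c0 scale0r.
Qed.

(** * Copolynomials and operators of infinite order *)

Section Copolynomials.
Variables (n : nat) (K : comNzRingType).
Implicit Types (T S Q : copoly n K) (p q : {mpoly K[n]}).
Implicit Type (a : 'X_{1..n} -> K).

Lemma copoly_of_linear (f : {mpoly K[n]} -> K^o) :
  linear f -> exists T : copoly n K, forall p, T p = f p.
Proof.
move=> f_lin.
pose L := GRing.isLinear.Build K {mpoly K[n]} K^o *:%R f f_lin.
pose T : {linear {mpoly K[n]} -> K^o} := HB.pack f L.
by exists T.
Qed.

Lemma copolyMnE T m p : copoly_val (T *+ m) p = T p *+ m.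
Proof. by elim: m => [//|m IHm]; rewrite !mulrS -IHm. Qed.

Lemma copoly_mulrn T p m : T (p *+ m) = T p *+ m.
Proof. exact: (raddfMn (T : {linear {mpoly K[n]} -> K^o})). Qed.

Lemma copoly_scale T b p : T (b *: p) = b * T p.
Proof. exact: (linearZ_LR (T : {linear {mpoly K[n]} -> K^o})). Qed.

Lemma copoly_sumE (I : Type) (r : seq I) (F : I -> copoly n K) p :
  copoly_val (\sum_(i <- r) F i) p = \sum_(i <- r) F i p.
Proof. by elim: r => [|i r IHr]; rewrite ?big_nil // !big_cons -IHr. Qed.

Lemma diffop_mulrn a T m : diffop a (T *+ m) = diffop a T *+ m.
Proof.
apply: copolyP => p; rewrite copolyMnE.
rewrite [LHS]/(diffop_fun a _ p) [X in _ = X *+ _]/(diffop_fun a _ p).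
rewrite /diffop_fun -sumrMnl; apply: eq_bigr => m' _.
by rewrite !copolyDE copolyMnE !mulrnAr.
Qed.

(** The transpose of [diffop a] on the polynomials of size at most [N], that is
  of degree less than [N].  Truncating there makes the sum finite, and its value
  at [p] is the same for all [N >= msize p]. *)
Definition diffop_adj a N : {mpoly K[n]} -> {mpoly K[n]} :=
  const_diffop (fun m => (-1) ^+ mdeg m * a m)
    [seq bmnm m | m : 'X_{1..n < N}].

Lemma diffop_adjE a N T p : (msize p <= N)%N ->
  diffop a T p = T (diffop_adj a N p).
Proof.
move=> le_pN; apply: etrans (diffop_funwE a T le_pN) _.
rewrite /diffop_adj /const_diffop big_image /=.
rewrite [RHS](raddf_sum (T : {linear {mpoly K[n]} -> K^o})).
apply: eq_bigr => m _.
by apply: etrans (esym (copoly_scale T _ _)); rewrite -mulrA [RHS]mulrCA.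
Qed.

(** The bound [N] can be kept through the iteration because derivatives do not
  raise the degree. *)
Lemma iter_diffopE a N k T p : (msize p <= N)%N ->
  iter k (diffop a) T p = T (iter k (diffop_adj a N) p).
Proof.
elim: k p => [//|k IHk] p le_pN; rewrite iterS (diffop_adjE _ _ le_pN).
rewrite IHk; last exact: leq_trans (msize_const_diffop _ _ _) le_pN.
by rewrite iterSr.
Qed.

Lemma iter_diffop_fact_dvd a Q : a 0%MM = 0 ->
  forall k p, exists b, iter k (diffop a) Q p = b *+ k`!.
Proof.
move=> a0 k p; rewrite (iter_diffopE _ _ _ (leqnn _)).
have c0 : (-1) ^+ mdeg (0%MM : 'X_{1..n}) * a 0%MM = 0 by rewrite a0 mulr0.
have [q ->] := @has_divided_powers_const_diffop n K
  (fun m => (-1) ^+ mdeg m * a m) [seq bmnm m | m : 'X_{1..n < msize p}] c0 k p.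
by exists (Q q); rewrite copoly_mulrn.
Qed.

(** The derivatives of positive order of [p] have size at most [d], and the
  term of order 0 is absent. *)
Lemma diffop_vanish a T d : a 0%MM = 0 ->
    (forall p, (msize p <= d)%N -> T p = 0) ->
  forall p, (msize p <= d.+1)%N -> diffop a T p = 0.
Proof.
move=> a0 T0 p le_pd; rewrite [LHS]/(diffop_fun a T p) /diffop_fun.
apply: big1 => m _; have [->|m_neq0] := eqVneq (m : 'X_{1..n}) 0%MM.
  by rewrite a0 mul0r.
rewrite copolyDE T0 ?mulr0 //; apply: leq_trans (msize_mderivm _ _) _.
by rewrite leq_subLR (leq_trans le_pd) // -add1n leq_add2r lt0n mdeg_eq0.
Qed.

Lemma iter_diffop_vanish a Q k p : a 0%MM = 0 ->
  (msize p <= k)%N -> iter k (diffop a) Q p = 0.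
Proof.
move=> a0; elim: k p => [|k IHk] p; last exact: diffop_vanish.
rewrite leqn0 msize_poly_eq0 => /eqP ->.
exact: (raddf0 (Q : {linear {mpoly K[n]} -> K^o})).
Qed.

(** The pointwise limit is linear because at [p], [q] and [b p + q] it agrees
  with a single [T_ k], for [k] large. *)
Lemma copoly_stationary_cvg (T_ : nat -> copoly n K) :
    (forall p, exists b, exists k0, forall k, (k0 <= k)%N -> T_ k p = b) ->
  exists T : copoly n K, T_ @ \oo --> T.
Proof.
move=> /boolp.choice[f fP].
have f_lin : linear (f : {mpoly K[n]} -> K^o).
  move=> b p q; have [k1 k1P] := fP (b *: p + q).
  have [[k2 k2P] [k3 k3P]] := (fP p, fP q).
  pose k := maxn k1 (maxn k2 k3).
  rewrite -(k1P k) ?leq_maxl // -(k2P k) ?leq_max ?leqnn ?orbT //.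
  by rewrite -(k3P k) ?leq_max ?leqnn ?orbT // copoly_linear.
have [T TE] := copoly_of_linear f_lin.
exists T; apply/copoly_cvgP => p; have [k0 k0P] := fP p.
by exists k0 => k le_k; rewrite TE k0P.
Qed.

End Copolynomials.

(** * Division by factorials in characteristic 0 *)

Section CharacteristicZero.
Variables (n : nat) (K : idomainType).
Hypothesis charK : [pchar K] =i pred0.

Lemma mulrn_fact_inj k : injective (fun x : K => x *+ k`!).
Proof.
move=> x y /= /eqP; rewrite -subr_eq0 -mulrnBl -mulr_natr mulf_eq0 subr_eq0.
rewrite ((pcharf0P K).1 charK) -[_ == 0%N]negbK -lt0n fact_gt0 orbF.
by move/eqP.
Qed.

Lemma copoly_mulrn_fact_inj k : injective (fun T : copoly n K => T *+ k`!).
Proof.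
move=> T S /= TS; apply: copolyP => p; apply: (@mulrn_fact_inj k) => /=.
by rewrite -!copolyMnE TS.
Qed.

(** The quotients of the values are unique, so they depend linearly on the
  polynomial. *)
Lemma copoly_fact_div k (T : copoly n K) :
    (forall p, exists b, T p = b *+ k`!) ->
  exists S : copoly n K, S *+ k`! = T.
Proof.
move=> /boolp.choice[f fP].
have f_lin : linear (f : {mpoly K[n]} -> K^o).
  move=> b p q; apply: (@mulrn_fact_inj k).
  by rewrite -fP copoly_linear !fP mulrnDl mulrnAr.
have [S SE] := copoly_of_linear f_lin.
by exists S; apply: copolyP => p; rewrite copolyMnE SE fP.
Qed.

End CharacteristicZero.

(** * The Cauchy problem *)

Theorem theorem6p2 (K : idomainType) (n : nat) (a : 'X_{1..n} -> K)
    (charK : [pchar K] =i pred0) (n_gt0 : (0 < n)%N) (a0 : a 0%MM = 0)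
    (Q : copoly n K) :
  exists u : copoly_series n K,
    [/\ forall k : nat,
          unique (fun S : copoly n K => S *+ k`! = iter k (diffop a) Q) (u k),
        unique (cauchy_solution a Q) u
      & forall t : K, exists S : copoly n K,
          (fun N : nat => \sum_(k < N) t ^+ k *: u k) @ \oo --> S].
Proof.
have /boolp.choice[u uE] k :
    exists S : copoly n K, S *+ k`! = iter k (diffop a) Q.
  exact: (copoly_fact_div charK (iter_diffop_fact_dvd Q a0 k)).
(* The recursion in the equation determines [k! v_k], hence [v_k]. *)
have solE v : cauchy_solution a Q v ->
    forall k, v k *+ k`! = iter k (diffop a) Q.
  move=> [dv v0]; elim=> [|k IHk]; first by rewrite v0.
  rewrite iterS -IHk diffop_mulrn -[diffop a (v k)]/(diffop_series a v k) -dv.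
  by rewrite /dt -mulrnA -factS.
exists u; split=> [k||t].
- split=> // S SE; apply: (copoly_mulrn_fact_inj charK (k := k)).
  by rewrite /= uE SE.
- split=> [|v /solE vE].
    split; last by rewrite -[LHS]/(u 0%N *+ 0`!) uE.
    apply/funext => k; apply: (copoly_mulrn_fact_inj charK (k := k)).
    by rewrite /= /dt -mulrnA -factS uE -diffop_mulrn uE.
  apply/funext => k; apply: (copoly_mulrn_fact_inj charK (k := k)).
  by rewrite /= uE vE.
apply: copoly_stationary_cvg => p.
have u_vanish k : (msize p <= k)%N -> u k p = 0.
  move=> le_pk; apply: (mulrn_fact_inj charK (k := k)).
  by rewrite /= -copolyMnE uE iter_diffop_vanish // mul0rn.
exists (copoly_val (\sum_(k < msize p) t ^+ k *: u k) p), (msize p) => N le_pN.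
rewrite !copoly_sumE -(subnKC le_pN) big_split_ord /=.
rewrite [X in _ + X]big1 ?addr0 //.
move=> i _; rewrite -[LHS]/(t ^+ (msize p + i) * u (msize p + i)%N p).
by rewrite u_vanish ?leq_addr // mulr0.
Qed.
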